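(* Let $(X_t)_{t\ge1}$ be a martingale difference sequence of random self-adjoint $d\times d$ matrices with respect to a filtration $(\mathcal{F}_t)_{t\ge0}$, and let $S_0=0$, $S_t:=\sum_{i\le t}X_i$. Let $(V_t)_{t\ge0}$ be an adapted, integrable sequence of random self-adjoint $d\times d$ matrices with $V_0=0$, and let $\psi:[0,\theta_{\max})\to\mathbb{R}$ be CGF-like. Suppose that, for every $\theta\in[0,\theta_{\max})$, the process $$R_t=\mathrm{tr}\left[\exp\left(\theta S_t-\psi(\theta)V_t\right)\right],\qquad t\ge0,$$ is a supermartingale. Then for every $n\ge1$, $r\in\mathbb{R}$, $\sigma>0$ and every $\theta\in[0,\theta_{\max})$, $$\mathbb{P}\left(\lambda_{\max}(S_n)\ge r,\ \lambda_{\max}(V_n)\le\sigma^2\right)\le\frac{e}{e-1}\left\{\mathrm{tr}\left[p\left(-\psi(\theta)\,\mathbb{E}V_n\right)\right]+1\right\}\exp\left(\psi(\theta)\sigma^2-\theta r\right).$$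
   Context: Matrices are real symmetric or complex Hermitian $d\times d$. $\lambda_{\max}$ is the maximum eigenvalue and $\mathrm{tr}$ the trace; functions of self-adjoint matrices are defined by spectral calculus. $p(u):=\min(-u,1)$ for $u\in\mathbb{R}$. A function $\psi:[0,\theta_{\max})\to\mathbb{R}$, with $\theta_{\max}\in(0,\infty]$, is CGF-like if it is strictly convex and twice continuously differentiable with $\psi(0)=\psi'_+(0)=0$ and $\sup_{\theta\in[0,\theta_{\max})}\psi(\theta)=\infty$. *)

(* Defs.v *)
From HB Require Import structures.
From mathcomp Require Export all_boot all_order all_algebra.
From mathcomp Require Export spectral.
From mathcomp Require Export all_classical all_reals all_analysis.
From mathcomp Require Export complex.

Set Implicit Arguments.
Unset Strict Implicit.
Unset Printing Implicit Defensive.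

Import Order.TTheory GRing.Theory Num.Theory.
Import numFieldNormedType.Exports.

Local Open Scope classical_set_scope.
Local Open Scope ring_scope.
Local Open Scope complex_scope.

(* Self-adjoint matrices are the elements of ['M[R[i]]_d] in [hermsymmx]. A real
   symmetric matrix is such a matrix with real entries, with the same
   eigenvalues, trace and functional calculus, so one statement over [R[i]]
   covers both the real symmetric and the complex Hermitian case. *)
Section SelfAdjoint.
Context {R : realType} {d : nat}.
Implicit Type A : 'M[R[i]]_d.

(* Spectral calculus: [A = P^-1 *m diag_mx D *m P] with [P := spectralmx A]
   unitary and, for Hermitian [A], [D := spectral_diag A] real. *)
Definition mxfun (f : R -> R) A : 'M[R[i]]_d :=
  invmx (spectralmx A)
    *m diag_mx (map_mx (fun z => (f (complex.Re z))%:C) (spectral_diag A))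
    *m spectralmx A.

Definition lambda_max A : R := sup [set x : R | eigenvalue A x%:C].

(* The trace of a Hermitian matrix is real; this is it as an element of [R]. *)
Definition rtr A : R := complex.Re (\tr A).

End SelfAdjoint.

Definition pfun (R : realType) (u : R) : R := Num.min (- u) 1.

Section CGF.
Context {R : realType}.

(* theta_max lies in (0, +oo], hence the extended real bound. *)
Definition cgf_dom (thmax : \bar R) : set R :=
  [set x | 0 <= x /\ (x%:E < thmax)%E].

(* Derivative relative to [D]: two-sided at interior points of [D], one-sided
   at an endpoint belonging to [D]. *)
Definition has_deriv_within (D : set R) (f : R -> R) (x l : R) : Prop :=
  (f y - f x) / (y - x) @[y --> within D x^'] --> l.

Definition strictly_convex_on (D : set R) (f : R -> R) : Prop :=
  forall x y t : R, D x -> D y -> x != y -> 0 < t -> t < 1 ->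
    f (t * x + (1 - t) * y) < t * f x + (1 - t) * f y.

(* [psi] is a total function whose values outside [[0, thmax)] are irrelevant;
   [psi1 0 = 0] is the condition on the right derivative at 0. *)
Definition cgf_like (thmax : \bar R) (psi : R -> R) : Prop :=
  [/\ strictly_convex_on (cgf_dom thmax) psi,
      psi 0 = 0,
      exists psi1 psi2 : R -> R,
        [/\ forall x, cgf_dom thmax x ->
              has_deriv_within (cgf_dom thmax) psi x (psi1 x),
            forall x, cgf_dom thmax x ->
              has_deriv_within (cgf_dom thmax) psi1 x (psi2 x),
            {within cgf_dom thmax, continuous psi2} &
            psi1 0 = 0] &
      ereal_sup [set (psi x)%:E | x in cgf_dom thmax] = +oo%E].

End CGF.

Section Processes.
Context {disp : measure_display} {T : measurableType disp} {R : realType}.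
Variable P : probability T R.

Definition filtration (F : nat -> set (set T)) : Prop :=
  [/\ forall t, sigma_algebra setT (F t),
      forall t, F t `<=` measurable &
      forall s t, (s <= t)%N -> F s `<=` F t].

Definition measurable_wrt (G : set (set T)) (X : T -> R) : Prop :=
  forall B : set R, measurable B -> G (X @^-1` B).

Definition integrable_rv (X : T -> R) : Prop :=
  P.-integrable setT (EFin \o X).

(* [Y] is a version of the conditional expectation E[X | G]. *)
Definition is_cond_exp (G : set (set T)) (X Y : T -> R) : Prop :=
  [/\ measurable_wrt G Y,
      integrable_rv Y &
      forall A, G A -> (\int[P]_(w in A) (Y w)%:E = \int[P]_(w in A) (X w)%:E)%E].

Definition supermartingale (F : nat -> set (set T)) (Z : nat -> T -> R) : Prop :=
  [/\ forall t, measurable_wrt (F t) (Z t),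
      forall t, integrable_rv (Z t) &
      forall t, exists2 Y : T -> R, is_cond_exp (F t) (Z t.+1) Y &
        {ae P, forall w, Y w <= Z t w}].

Section Matrices.
Context {d : nat}.
Implicit Type M : T -> 'M[R[i]]_d.

(* [Q] holds for every real coordinate of the random matrix [M]. *)
Definition coordwise (Q : (T -> R) -> Prop) M : Prop :=
  forall i j, Q (fun w => complex.Re (M w i j)) /\ Q (fun w => complex.Im (M w i j)).

Definition mx_measurable_wrt (G : set (set T)) M := coordwise (measurable_wrt G) M.

Definition mx_integrable M := coordwise integrable_rv M.

Definition mx_expectation M : 'M[R[i]]_d :=
  \matrix_(i, j) Complex
    (fine 'E_P[fun w => complex.Re (M w i j)]) (fine 'E_P[fun w => complex.Im (M w i j)]).

(* The sequence is [X_t] for [t >= 1]; the value [X 0] is unused. *)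
Definition mx_martingale_difference (F : nat -> set (set T))
    (X : nat -> T -> 'M[R[i]]_d) : Prop :=
  forall t, (1 <= t)%N ->
    [/\ mx_measurable_wrt (F t) (X t),
        mx_integrable (X t) &
        coordwise (fun x => is_cond_exp (F t.-1) x (cst 0)) (X t)].

Definition partial_sum (X : nat -> T -> 'M[R[i]]_d) (t : nat) (w : T) :
    'M[R[i]]_d :=
  \sum_(1 <= i < t.+1) X i w.

End Matrices.
End Processes.

(* Main.v *)
Require Import Defs.
From mathcomp Require Import ring lra measurable_realfun.

(** Fix [theta], put [M := theta S_n - psi(theta) V_n], and let
    [u0 := theta r - psi(theta) sigma^2]. Since [theta] and [psi theta] are
    nonnegative, on the event in question the largest eigenvalue of [M] is at
    least [u0] ([lambda_maxB_ge], [cgf_like_ge0]). The bound is Markov's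
    inequality for a variable that dominates [tr phi(M) + 1], where
    [phi u := exp u - 1 + p u].

    The function [phi] is nonnegative, and [phi u + 1 >= (1 - 1/e) exp u] for
    every real [u]; so [tr phi(M) + 1] is nonnegative everywhere and at least
    [(1 - 1/e) exp u0] on the event ([expR_pfun_lower], [trace_majorant]).
    Adding 1 before applying Markov is what makes this lower bound a multiple
    of [exp], and it is the source of the [+ 1] and of the factor
    [e / (e - 1)].

    In expectation the exponential and the constant cancel: [tr exp(M)] is the
    value at time [n] of a supermartingale that starts at [d = tr I]
    ([supermartingale_Rintegral]). What remains is [E tr p(M)], to be compared
    with [tr p(E M)], where [E M = - psi(theta) E V_n] because the martingale
    [S_n] is centred. As [p] is a minimum of two affine functions it is concave;
    by Peierls' inequality [tr p(M)] is at most the sum of the [p(<q_i, M q_i>)]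
    over any orthonormal basis ([peierls_pfun]). Taking for the [q_i] a fixed
    eigenbasis of [E M] turns the matrix statement into the scalar Jensen
    inequality for each [i] ([jensen_pfun]), the mean of [<q_i, M q_i>] being
    the [i]-th eigenvalue of [E M]. The variable to which Markov is applied is
    therefore defined from these diagonal entries, whose measurability is plain,
    instead of from [tr p(M)].

    The event itself has to be shown measurable, since [P] is only controlled on
    measurable sets: [lambda_max A > c] holds iff [v A v^* > c |v|^2] for one of
    the countably many vectors [v] with rational coordinates
    ([lt_lambda_maxP], [measurable_lambda_max]). *)

Set Implicit Arguments.
Unset Strict Implicit.
Unset Printing Implicit Defensive.

Import Order.TTheory GRing.Theory Num.Theory.
Import numFieldNormedType.Exports.

Local Open Scope classical_set_scope.
Local Open Scope ring_scope.
Local Open Scope sesquilinear_scope.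
Local Open Scope complex_scope.

(** * Complex parts and Hermitian matrices *)

Section ComplexParts.
Context {R : realType}.
Implicit Types z : R[i].

Lemma Re_sum (I : Type) (s : seq I) (Q : pred I) (f : I -> R[i]) :
  complex.Re (\sum_(i <- s | Q i) f i) = \sum_(i <- s | Q i) complex.Re (f i).
Proof. by apply: (big_morph (@complex.Re R)) => // -[a b] [c e]. Qed.

Lemma Im_sum (I : Type) (s : seq I) (Q : pred I) (f : I -> R[i]) :
  complex.Im (\sum_(i <- s | Q i) f i) = \sum_(i <- s | Q i) complex.Im (f i).
Proof. by apply: (big_morph (@complex.Im R)) => // -[a b] [c e]. Qed.

Lemma Re_mul z z' : complex.Re (z * z') =
  complex.Re z * complex.Re z' - complex.Im z * complex.Im z'.
Proof. by case: z z' => [a b] [c e]. Qed.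

Lemma Re_scale (a : R) z : complex.Re (a%:C * z) = a * complex.Re z.
Proof. by rewrite Re_mul /= mul0r subr0. Qed.

Lemma Re_mulJ_ge0 z : 0 <= complex.Re (z * Num.conj z).
Proof.
by case: z => a b /=; rewrite mulrN opprK addr_ge0 // -expr2 sqr_ge0.
Qed.

Lemma mulJE z : z * Num.conj z = (complex.Re (z * Num.conj z))%:C.
Proof. by case: z => a b; rewrite /= /GRing.mul /=; congr Complex; ring. Qed.

End ComplexParts.

Section Hermitian.
Context {R : realType} {d : nat}.
Implicit Types A B : 'M[R[i]]_d.

Lemma hermP A : A \is hermsymmx <-> forall i j, A i j = Num.conj (A j i).
Proof.
split=> [/is_hermitianmxP hA i j|hA].
  by rewrite {1}hA expr0 scale1r !mxE.
apply/is_hermitianmxP; rewrite expr0 scale1r.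
by apply/matrixP => i j; rewrite !mxE.
Qed.

Lemma hermD A B : A \is hermsymmx -> B \is hermsymmx -> A + B \is hermsymmx.
Proof.
move=> /hermP hA /hermP hB; apply/hermP => i j.
by rewrite !mxE hA hB rmorphD.
Qed.

Lemma hermZ (a : R) A : A \is hermsymmx -> a%:C *: A \is hermsymmx.
Proof.
move=> /hermP hA; apply/hermP => i j; rewrite !mxE hA rmorphM; congr (_ * _).
exact/esym/conjc_real.
Qed.

Lemma hermN A : A \is hermsymmx -> - A \is hermsymmx.
Proof. by move=> /hermP hA; apply/hermP => i j; rewrite !mxE hA rmorphN. Qed.

Lemma herm0 : (0 : 'M[R[i]]_d) \is hermsymmx.
Proof. by apply/hermP => i j; rewrite !mxE rmorph0. Qed.

Lemma herm_sum (I : eqType) (s : seq I) (A : I -> 'M[R[i]]_d) :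
  {in s, forall i, A i \is hermsymmx} -> \sum_(i <- s) A i \is hermsymmx.
Proof.
move=> hA; rewrite big_seq; apply: (big_ind (fun B => B \is hermsymmx)) => //.
- exact: herm0.
- exact: hermD.
Qed.

End Hermitian.

(** * Quadratic forms and spectral weights *)

Section QuadraticForm.
Context {R : realType} {d : nat}.
Implicit Types (A B : 'M[R[i]]_d) (v : 'rV[R[i]]_d).

Definition qform v A : R := complex.Re ((v *m A *m v ^t*) 0 0).

Definition sqnorm v : R := qform v 1%:M.

(** The eigenvalues, as reals; only meaningful for Hermitian [A]. *)
Definition eigval A (j : 'I_d) : R := complex.Re (spectral_diag A 0 j).

(** The squared modulus of the [j]-th coordinate of [v] in the eigenbasis. *)
Definition weight A v (j : 'I_d) : R :=
  let w := v *m (spectralmx A) ^t* in complex.Re (w 0 j * Num.conj (w 0 j)).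

(** Real-bilinear expansion: it reduces measurability, integrability and limits
    of quadratic forms to the real coordinates of [v] and [A]. *)
Lemma qformE v A : qform v A = \sum_i \sum_j
  (complex.Re (v 0 i * Num.conj (v 0 j)) * complex.Re (A i j)
   - complex.Im (v 0 i * Num.conj (v 0 j)) * complex.Im (A i j)).
Proof.
rewrite /qform mxE Re_sum exchange_big; apply: eq_bigr => j _.
rewrite !mxE big_distrl Re_sum /=; apply: eq_bigr => i _.
by rewrite -Re_mul; congr complex.Re; ring.
Qed.

Lemma qformD v A B : qform v (A + B) = qform v A + qform v B.
Proof.
rewrite /qform mulmxDr mulmxDl mxE.
by case: (X in X + _) => a b; case: (X in _ + X).
Qed.

Lemma qformZ v (a : R) A : qform v (a%:C *: A) = a * qform v A.
Proof. by rewrite /qform -scalemxAr -scalemxAl mxE Re_scale. Qed.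

Lemma qform0 v : qform v 0 = 0.
Proof. by rewrite /qform mulmx0 mul0mx mxE. Qed.

Lemma qform_sum v (I : Type) (s : seq I) (A : I -> 'M[R[i]]_d) :
  qform v (\sum_(i <- s) A i) = \sum_(i <- s) qform v (A i).
Proof. exact: (big_morph (qform v) (qformD v) (qform0 v)). Qed.

Lemma qformB v A B : qform v (A - B) = qform v A - qform v B.
Proof.
by rewrite -scaleN1r (_ : -1 = (-1)%:C) ?qformD ?qformZ ?mulN1r // rmorphN1.
Qed.

Lemma qform_eigenvector v A (x : R) :
  v *m A = x%:C *: v -> qform v A = x * sqnorm v.
Proof.
by move=> vA; rewrite /sqnorm /qform vA mulmx1 -scalemxAl mxE Re_scale.
Qed.

Lemma sqnormE v : sqnorm v = \sum_j complex.Re (v 0 j * Num.conj (v 0 j)).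
Proof.
rewrite /sqnorm /qform mulmx1 mxE Re_sum.
by apply: eq_bigr => j _; rewrite !mxE.
Qed.

Lemma sqnorm_gt0 v : v != 0 -> 0 < sqnorm v.
Proof.
rewrite lt0r sqnormE => v0; apply/andP; split; last first.
  by apply: sumr_ge0 => j _; exact: Re_mulJ_ge0.
apply: contra v0; rewrite psumr_eq0 => [/allP vj|j _]; last exact: Re_mulJ_ge0.
apply/eqP/rowP => j; rewrite mxE.
have := vj j (mem_index_enum j) => /= /eqP h.
apply/eqP; have := mulJE (v 0 j).
by rewrite h => /eqP; rewrite mulf_eq0 conjC_eq0 orbb.
Qed.

Lemma weight_ge0 A v j : 0 <= weight A v j.
Proof. exact: Re_mulJ_ge0. Qed.

Lemma sum_weight A v : \sum_j weight A v j = sqnorm v.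
Proof.
have /unitarymxP uP : (spectralmx A)^t* \is unitarymx.
  by rewrite trmxC_unitary spectral_unitarymx.
rewrite -[LHS](sqnormE (v *m (spectralmx A) ^t*)).
rewrite /sqnorm /qform !mulmx1 trmx_mul map_mxM mulmxA.
by rewrite -[v *m _ *m _]mulmxA uP mulmx1.
Qed.

Lemma eigval_diag A : A \is hermsymmx ->
  spectral_diag A = \row_j (eigval A j)%:C.
Proof.
move=> /hermitian_spectral_diag_real /mxOverP h.
by apply/rowP => j; rewrite mxE /eigval RRe_real.
Qed.

Lemma spectral_decomp A : A \is hermsymmx ->
  A = (spectralmx A)^t* *m diag_mx (\row_j (eigval A j)%:C) *m spectralmx A.
Proof.
move=> hA; have /orthomx_spectralP := hermitian_normalmx hA.
by rewrite invmx_unitary ?spectral_unitarymx // eigval_diag.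
Qed.

Lemma qform_weight A v : A \is hermsymmx ->
  qform v A = \sum_j weight A v j * eigval A j.
Proof.
move=> hA; rewrite {1}(spectral_decomp hA) /qform.
set w := v *m (spectralmx A)^t*.
set D := diag_mx _.
have -> : v *m ((spectralmx A)^t* *m D *m spectralmx A) *m v^t*
    = w *m D *m w^t*.
  by rewrite /w trmx_mul map_mxM trmxCK !mulmxA.
rewrite /D mul_mx_diag mxE Re_sum; apply: eq_bigr => j _.
rewrite [w^t* j 0]mxE [w^T j 0]mxE mxE [X in _ * X * _]mxE /weight -/w.
by rewrite mulrAC mulrC Re_scale mulrC.
Qed.

Lemma rtr_mxfun (f : R -> R) A : rtr (mxfun f A) = \sum_j f (eigval A j).
Proof.
rewrite /rtr /mxfun mxtrace_mulC mulmxA mulmxV ?spectral_unit // mul1mx.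
by rewrite mxtrace_diag Re_sum; apply: eq_bigr => j _; rewrite mxE.
Qed.

Lemma eigval0 j : eigval (0 : 'M[R[i]]_d) j = 0.
Proof.
have /orthomx_spectralP h := hermitian_normalmx (@herm0 R d).
pose U := spectralmx (0 : 'M[R[i]]_d).
have : U *m 0 *m invmx U = 0.
  by rewrite mulmx0 mul0mx.
rewrite {1}h !mulmxA mulmxV ?spectral_unit // mul1mx mulmxK ?spectral_unit //.
by move=> /matrixP/(_ j j); rewrite !mxE eqxx mulr1n /eigval => ->.
Qed.

Lemma row_eigenvector A j : A \is hermsymmx ->
  row j (spectralmx A) *m A = (eigval A j)%:C *: row j (spectralmx A).
Proof.
move=> hA; have /unitarymxP uP := spectral_unitarymx A.
rewrite -row_mul {2}(spectral_decomp hA) !mulmxA uP mul1mx.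
by apply/rowP => k; rewrite mul_diag_mx !mxE.
Qed.

Lemma sqnorm_row (Q : 'M[R[i]]_d) i : Q \is unitarymx -> sqnorm (row i Q) = 1.
Proof.
move=> /unitarymxP/matrixP/(_ i i); rewrite !mxE eqxx => h.
rewrite sqnormE -Re_sum; have -> : 1 = complex.Re (true%:R : R[i]) by [].
by rewrite -h; congr complex.Re; apply: eq_bigr => j _; rewrite !mxE.
Qed.

Lemma qform_row_spectral A j : A \is hermsymmx ->
  qform (row j (spectralmx A)) A = eigval A j.
Proof.
move=> hA; rewrite (qform_eigenvector (row_eigenvector j hA)).
by rewrite sqnorm_row ?mulr1 // spectral_unitarymx.
Qed.

(** The matrix of weights is doubly stochastic: its rows sum to 1 because the
    vectors are unit vectors, its columns because the [row i Q] also form an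
    orthonormal basis. *)
Lemma sum_weight_row (Q A : 'M[R[i]]_d) j : Q \is unitarymx ->
  \sum_i weight A (row i Q) j = 1.
Proof.
move=> uQ; pose W := Q *m (spectralmx A)^t*.
have uW : W^T \is unitarymx.
  by rewrite trmx_unitary mul_unitarymx // trmxC_unitary spectral_unitarymx.
rewrite -(sqnorm_row j uW) sqnormE; apply: eq_bigr => i _.
by rewrite /weight -row_mul -/W !mxE.
Qed.

(** The supremum defining [lambda_max] is attained: every real eigenvalue is a
    value of the quadratic form on a unit vector, hence an average of the
    [eigval A k], and these are eigenvalues themselves. *)
Lemma lambda_max_eigval A : (0 < d)%N -> A \is hermsymmx ->
  exists j, lambda_max A = eigval A j /\ forall k, eigval A k <= eigval A j.
Proof.
move=> d0 hA; pose j := [arg max_(k > Ordinal d0) eigval A k]%O.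
have jmax k : eigval A k <= eigval A j.
  by rewrite /j; case: arg_maxP => // l _; apply.
exists j; split=> //.
have ub : ubound [set x : R | eigenvalue A x%:C] (eigval A j).
  move=> x /= /eigenvalueP[v vA v0]; have n0 := sqnorm_gt0 v0.
  rewrite -(ler_pM2r n0) -(qform_eigenvector vA) qform_weight //.
  rewrite -(sum_weight A) mulr_sumr ler_sum // => k _.
  by rewrite mulrC ler_wpM2r ?weight_ge0.
have ej : [set x : R | eigenvalue A x%:C] (eigval A j).
  apply/eigenvalueP; exists (row j (spectralmx A)).
    exact: row_eigenvector.
  apply/eqP => r0; have := sqnorm_row j (spectral_unitarymx A).
  rewrite r0 /sqnorm /qform mul0mx mul0mx mxE => /eqP.
  by rewrite eq_sym oner_eq0.
apply/le_anti/andP; split; first by apply: ge_sup => //; exists (eigval A j).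
by apply: ub_le_sup => //; exists (eigval A j).
Qed.

Lemma qform_le_lambda_max A v : (0 < d)%N -> A \is hermsymmx ->
  qform v A <= lambda_max A * sqnorm v.
Proof.
move=> d0 hA; have [j [-> jmax]] := lambda_max_eigval d0 hA.
rewrite qform_weight // -(sum_weight A) mulr_sumr ler_sum // => k _.
by rewrite mulrC ler_wpM2r ?weight_ge0.
Qed.

Lemma lambda_max_attained A : (0 < d)%N -> A \is hermsymmx ->
  exists2 v, sqnorm v = 1 & qform v A = lambda_max A.
Proof.
move=> d0 hA; have [j [-> _]] := lambda_max_eigval d0 hA.
exists (row j (spectralmx A)); last exact: qform_row_spectral.
by rewrite sqnorm_row ?spectral_unitarymx.
Qed.

(** Evaluate both quadratic forms at a unit eigenvector for [lambda_max A]. *)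
Lemma lambda_maxB_ge A B (a b : R) : (0 < d)%N -> 0 <= b ->
  A \is hermsymmx -> B \is hermsymmx ->
  a * lambda_max A - b * lambda_max B <= lambda_max (a%:C *: A - b%:C *: B).
Proof.
move=> d0 b0 hA hB; have [v v1 vA] := lambda_max_attained d0 hA.
have hAB : a%:C *: A - b%:C *: B \is hermsymmx.
  by apply: hermD; [|apply: hermN]; exact: hermZ.
have := qform_le_lambda_max v d0 hAB; rewrite v1 mulr1; apply: le_trans.
rewrite qformB !qformZ vA lerD2l lerN2 ler_wpM2l //.
by have := qform_le_lambda_max v d0 hB; rewrite v1 mulr1.
Qed.

End QuadraticForm.

(** * Trace inequalities for [p] *)

Section TraceInequalities.
Context {R : realType} {d : nat}.
Implicit Types (A B Q : 'M[R[i]]_d) (v : 'rV[R[i]]_d).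

Lemma pfun_le_opp (u : R) : pfun u <= - u.
Proof. by rewrite /pfun ge_min lexx. Qed.

Lemma pfun_le1 (u : R) : pfun u <= 1.
Proof. by rewrite /pfun ge_min lexx orbT. Qed.

Lemma pfun_concave (I : finType) (w x : I -> R) :
  (forall i, 0 <= w i) -> \sum_i w i = 1 ->
  \sum_i w i * pfun (x i) <= pfun (\sum_i w i * x i).
Proof.
move=> w0 w1; rewrite {2}/pfun le_min; apply/andP; split.
  rewrite -sumrN; apply: ler_sum => i _.
  by rewrite -mulrN ler_wpM2l // pfun_le_opp.
by rewrite -w1; apply: ler_sum => i _; rewrite ler_piMr // pfun_le1.
Qed.

(** Each diagonal entry [<q_i, A q_i>] is an average of the eigenvalues of [A]
    with weights that also sum to 1 over [i]; apply concavity for each [i] and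
    exchange the two sums. *)
Lemma peierls_pfun Q A : Q \is unitarymx -> A \is hermsymmx ->
  \sum_j pfun (eigval A j) <= \sum_i pfun (qform (row i Q) A).
Proof.
move=> uQ hA.
rewrite (eq_bigr (fun j => \sum_i weight A (row i Q) j * pfun (eigval A j))).
  rewrite exchange_big ler_sum // => i _; rewrite qform_weight //.
  apply: pfun_concave => [j|]; first exact: weight_ge0.
  by rewrite sum_weight sqnorm_row.
by move=> j _; rewrite -mulr_suml sum_weight_row // mul1r.
Qed.

(** Where [p u = - u] this is [1 + u <= exp u]; where [p u = 1] it is
    positivity of [exp]. *)
Lemma expR_pfun_ge0 (u : R) : 0 <= expR u - 1 + pfun u.
Proof.
rewrite /pfun; case: (leP (- u) 1) => _; last by rewrite subrK expR_ge0.
by have := expR_ge1Dx u; lra.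
Qed.

(** Where [p u = - u] the claim reads [u <= exp (u - 1)], the tangent line
    bound for [exp] at 1, which is where the constant [1 - 1/e] comes from. *)
Lemma expR_pfun_lower (u : R) :
  (expR 1 - 1) / expR 1 * expR u <= expR u - 1 + pfun u + 1.
Proof.
have e0 := expR_gt0 (1 : R); have eu := expR_gt0 u.
have -> : (expR 1 - 1) / expR 1 * expR u = expR u - expR (u - 1) :> R.
  by rewrite expRB mulrBl divff ?gt_eqF // mulrBl mul1r mul1r mulrC.
have := expR_ge1Dx (u - 1); have := expR_gt0 (u - 1).
by rewrite /pfun; case: (leP (- u) 1) => _; lra.
Qed.

(** [Z] dominates the trace of [exp u - 1 + p u] at [A], plus 1. That trace is a
    sum of nonnegative terms, so it is at least its [j]-th term. *)
Lemma trace_majorant Q A : Q \is unitarymx -> A \is hermsymmx ->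
  let Z := rtr (mxfun (@expR R) A) - d%:R
           + \sum_i pfun (qform (row i Q) A) + 1 in
  0 <= Z /\ forall j, (expR 1 - 1) / expR 1 * expR (eigval A j) <= Z.
Proof.
move=> uQ hA Z.
pose f j := expR (eigval A j) - 1 + pfun (eigval A j).
have f0 j : 0 <= f j by exact: expR_pfun_ge0.
have fZ : \sum_j f j + 1 <= Z.
  rewrite /Z lerD2r /f big_split /= lerD //; last exact: peierls_pfun.
  rewrite rtr_mxfun big_split /= lerD2l.
  by rewrite big_const_ord iter_addr addr0 mulNrn.
split; first by apply: le_trans fZ; rewrite addr_ge0 // sumr_ge0.
move=> j; apply: le_trans fZ; apply: le_trans (expR_pfun_lower _) _.
by rewrite lerD2r -/(f j) (bigD1 j) //= lerDl sumr_ge0.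
Qed.

End TraceInequalities.

(** * Sign of a CGF-like function *)

Section CGFSign.
Context {R : realType}.

(** If [psi theta < 0], convexity keeps the difference quotient [psi y / y]
    below [psi theta / theta < 0] for [0 < y < theta], which contradicts
    [psi'(0) = 0]. *)
Lemma cgf_like_ge0 (thmax : \bar R) (psi : R -> R) (theta : R) :
  cgf_like thmax psi -> cgf_dom thmax theta -> 0 <= psi theta.
Proof.
move=> [conv psi0 [psi1 [psi2 [der _ _ psi10]]] _] [th0 thm].
have [->|thN0] := eqVneq theta 0; first by rewrite psi0.
have {}th0 : 0 < theta by rewrite lt0r thN0.
have D0 : cgf_dom thmax 0.
  by split => //; apply: le_lt_trans thm; rewrite lee_fin ltW.
rewrite leNgt; apply/negP => psi_lt0.
pose e := - psi theta / theta.
have e0 : 0 < e by rewrite divr_gt0 // oppr_gt0.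
have := der _ D0; rewrite /has_deriv_within psi10 => /cvgrPdist_lt /(_ e e0).
rewrite /within /dnbhs /= => /nbhs_ballP[dl /= dl0 near0].
pose y := Num.min dl theta / 2.
have m0 : 0 < Num.min dl theta by rewrite lt_min dl0.
have y0 : 0 < y by rewrite divr_gt0.
have ym : y < Num.min dl theta by rewrite /y ltr_pdivrMr // ltr_pMr // ltr1n.
have [ydl yth] : y < dl /\ y < theta by apply/andP; rewrite -lt_min.
have Dy : cgf_dom thmax y.
  by split; [exact: ltW | apply: lt_trans thm; rewrite lte_fin].
have /near0/(_ (lt0r_neq0 y0) Dy) : ball (0 : R) dl y.
  by rewrite /ball /= sub0r normrN gtr0_norm.
rewrite psi0 !subr0 sub0r normrN => h.
pose t := y / theta.
have t0 : 0 < t by rewrite divr_gt0.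
have t1 : t < 1 by rewrite ltr_pdivrMr // mul1r.
have := conv theta 0 t (conj (ltW th0) thm) D0 thN0 t0 t1.
rewrite psi0 !mulr0 !addr0 /t mulfVK // => cy.
have : psi y / y < - e.
  rewrite ltr_pdivrMr // (_ : - e * y = y / theta * psi theta) //.
  by rewrite /e !mulNr opprK mulrC mulrA mulrAC.
rewrite ltNge => /negP; apply.
by move: h => /ltW; rewrite ler_norml => /andP[].
Qed.

End CGFSign.

(** * Measurability of the largest eigenvalue *)

Section Measurability.
Context {R : realType} {d : nat}.
Implicit Types (A : 'M[R[i]]_d) (v : 'rV[R[i]]_d).

Definition rat_vector (q : {ffun 'I_d -> rat * rat}) : 'rV[R[i]]_d :=
  \row_j Complex (ratr (q j).1) (ratr (q j).2).

Lemma rat_approx (x : R) :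
  exists u : nat -> rat, (fun n => ratr (u n) : R) @ \oo --> x.
Proof.
have h n : exists q : rat, `|x - ratr q| < n.+1%:R^-1.
  have n0 : (0 : R) < n.+1%:R^-1 by rewrite invr_gt0.
  have [|q] := @rat_in_itvoo R (x - n.+1%:R^-1) (x + n.+1%:R^-1).
    by rewrite ltrBlDr -addrA ltrDl addr_gt0.
  by rewrite in_itv /= => /andP[q1 q2]; exists q; rewrite ltr_distlC q1 q2.
have [u hu] := choice h; exists u; apply/cvgrPdist_lt => e e0.
near=> n; apply: lt_trans (hu n) _.
near: n; exact: near_infty_natSinv_lt (PosNum e0).
Unshelve. all: by end_near. Qed.

Lemma cvg_qform (vs : nat -> 'rV[R[i]]_d) v A :
  (forall j, complex.Re (vs n 0 j) @[n --> \oo] --> complex.Re (v 0 j)) ->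
  (forall j, complex.Im (vs n 0 j) @[n --> \oo] --> complex.Im (v 0 j)) ->
  qform (vs n) A @[n --> \oo] --> qform v A.
Proof.
move=> hre him; rewrite qformE; under eq_fun do rewrite qformE.
have mulJ (z z' : R[i]) : z * Num.conj z' = Complex
    (complex.Re z * complex.Re z' + complex.Im z * complex.Im z')
    (complex.Im z * complex.Re z' - complex.Re z * complex.Im z').
  case: z z' => [a b] [a' b'] /=.
  transitivity (Complex (a * a' - b * - b') (a * - b' + b * a')) => //.
  by congr Complex; ring.
apply: cvg_big => [|i _]; first exact: add_continuous.
apply: cvg_big => [|j _]; first exact: add_continuous.
rewrite mulJ; under eq_fun do rewrite mulJ.
by apply: cvgB; apply: cvgMl; [apply: cvgD|apply: cvgB]; apply: cvgM.
Qed.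

(** The strict inequality is an open condition on [v]. *)
Lemma rat_vector_dense A B v : qform v A < qform v B ->
  exists q, qform (rat_vector q) A < qform (rat_vector q) B.
Proof.
move=> vAB.
have [a ha] := choice (fun j => rat_approx (complex.Re (v 0 j))).
have [b hb] := choice (fun j => rat_approx (complex.Im (v 0 j))).
pose q n := [ffun j => (a j n, b j n)].
have : qform (rat_vector (q n)) (B - A) @[n --> \oo] --> qform v (B - A).
  apply: cvg_qform => j; under eq_fun do rewrite mxE ffunE /=.
    exact: ha.
  exact: hb.
move=> /cvgr_gt /(_ 0); rewrite qformB subr_gt0 => /(_ vAB).
move=> [N _ /(_ N (leqnn N))] /=; rewrite qformB subr_gt0 => h.
by exists (q N).
Qed.

(** The form of [c I] is [c |v|^2], so this is the variational
    characterization of [lambda_max] restricted to a countable dense set. *)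
Lemma lt_lambda_maxP A (c : R) : (0 < d)%N -> A \is hermsymmx ->
  (c < lambda_max A) <->
  exists q, qform (rat_vector q) (c%:C *: 1%:M) < qform (rat_vector q) A.
Proof.
move=> d0 hA; split=> [cA|[q]].
  have [v v1 vA] := lambda_max_attained d0 hA.
  by apply: (@rat_vector_dense _ _ v); rewrite qformZ -/(sqnorm v) v1 mulr1 vA.
rewrite qformZ => cA.
have := lt_le_trans cA (qform_le_lambda_max _ d0 hA).
rewrite ltNge [c < _]ltNge; apply: contra => Ac.
by rewrite ler_wpM2r // -(sum_weight A) sumr_ge0 // => j _; exact: weight_ge0.
Qed.

Context {disp : measure_display} {T : measurableType disp}.
Implicit Type M : T -> 'M[R[i]]_d.

Lemma measurable_qform v M : coordwise (measurable_fun setT) M ->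
  measurable_fun setT (fun w => qform v (M w)).
Proof.
move=> mM; under eq_fun do rewrite qformE.
apply: measurable_sum => i; apply: measurable_sum => j.
have [mre mim] := mM i j.
by apply: measurable_funB; apply: measurable_funM.
Qed.

Lemma measurable_lambda_max M : (0 < d)%N -> (forall w, M w \is hermsymmx) ->
  coordwise (measurable_fun setT) M ->
  measurable_fun setT (fun w => lambda_max (M w)).
Proof.
move=> d0 hM mM; apply: (measurability _ (RGenOInfty.measurableE R)).
move=> /= _ [_ [c ->] <-]; rewrite setTI.
rewrite (_ : _ @^-1` _ = \bigcup_q
  [set w | qform (rat_vector q) (c%:C *: 1%:M) < qform (rat_vector q) (M w)]).
  apply: countable_bigcupT_measurable => // q.
  have := @measurable_fun_ltr _ T R setT _ _
    (measurable_cst (qform (rat_vector q) (c%:C *: 1%:M)))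
    (measurable_qform (rat_vector q) mM).
  by move=> /(_ measurableT [set true] I); rewrite setTI.
apply/seteqP; split => w /=; rewrite in_itv /= andbT.
  by move=> /(lt_lambda_maxP _ d0 (hM w)) [q hq]; exists q.
by move=> [q _ hq]; apply/(lt_lambda_maxP _ d0 (hM w)); exists q.
Qed.

End Measurability.

(** * Integrals of random variables and random matrices *)

Section Expectation.
Context {disp : measure_display} {T : measurableType disp} {R : realType}.
Variable P : probability T R.
Implicit Types f g : T -> R.

Lemma integrable_rv_measurable f : integrable_rv P f -> measurable_fun setT f.
Proof. by move=> /measurable_int /measurable_EFinP. Qed.

Lemma integrable_rvD f g : integrable_rv P f -> integrable_rv P g ->
  integrable_rv P (fun w => f w + g w).
Proof. exact: integrableD. Qed.

Lemma integrable_rvZ (a : R) f : integrable_rv P f ->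
  integrable_rv P (fun w => a * f w).
Proof. exact: integrableZl. Qed.

Lemma integrable_rvB f g : integrable_rv P f -> integrable_rv P g ->
  integrable_rv P (fun w => f w - g w).
Proof. exact: integrableB. Qed.

Lemma integrable_rv_cst (a : R) : integrable_rv P (fun=> a).
Proof. exact: finite_measure_integrable_cst. Qed.

Lemma integrable_rv_sum (I : Type) (s : seq I) (f : I -> T -> R) :
  (forall i, integrable_rv P (f i)) ->
  integrable_rv P (fun w => \sum_(i <- s) f i w).
Proof.
move=> If; elim: s => [|i s IH].
  by under eq_fun do rewrite big_nil; exact: integrable_rv_cst.
by under eq_fun do rewrite big_cons; exact: integrable_rvD.
Qed.

Lemma Rintegral_sum_rv (I : Type) (s : seq I) (f : I -> T -> R) :
  (forall i, integrable_rv P (f i)) ->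
  \int[P]_w (\sum_(i <- s) f i w) = \sum_(i <- s) \int[P]_w f i w.
Proof.
move=> If; elim: s => [|i s IH].
  rewrite big_nil; under eq_Rintegral do rewrite big_nil.
  by rewrite Rintegral_cst // mul0r.
rewrite big_cons -IH; under eq_Rintegral do rewrite big_cons.
by rewrite RintegralD //; [exact: If | exact: integrable_rv_sum].
Qed.

Lemma Rintegral_prob_cst (a : R) : \int[P]_w a = a.
Proof.
rewrite Rintegral_cst // [X in fine X](_ : _ = P setT) //.
by rewrite probability_setT mulr1.
Qed.

(** [g - f] agrees almost everywhere with its absolute value, whose integral is
    nonnegative. *)
Lemma ae_le_Rintegral f g : integrable_rv P f -> integrable_rv P g ->
  {ae P, forall w, f w <= g w} -> \int[P]_w f w <= \int[P]_w g w.
Proof.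
move=> If Ig fg.
have mf := integrable_rv_measurable If; have mg := integrable_rv_measurable Ig.
have mgf : measurable_fun setT (fun w => g w - f w) by exact: measurable_funB.
rewrite -subr_ge0 -RintegralB //.
have -> : \int[P]_w (g w - f w) = \int[P]_w `|g w - f w|.
  congr fine; apply: ae_eq_integral => //.
  - exact/measurable_EFinP.
  - by apply/measurable_EFinP; exact: measurableT_comp.
  - by apply: filterS fg => w fgw _; rewrite ger0_norm ?subr_ge0.
by apply: Rintegral_ge0 => w _.
Qed.

Lemma integrable_pfun f : integrable_rv P f ->
  integrable_rv P (fun w => pfun (f w)).
Proof.
move=> If; have mf := integrable_rv_measurable If.
apply: (@le_integrable _ _ _ _ _ measurableT _ (EFin \o (fun w => `|f w| + 1))).
- apply/measurable_EFinP; apply: measurable_minr => //.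
  exact: measurableT_comp.
- move=> w _; rewrite /= lee_fin [leRHS]ger0_norm ?addr_ge0 // ler_norml.
  have := ler_norm (f w); have := ler_norm (- f w); rewrite normrN.
  move=> h1 h2; rewrite /pfun; case: (leP (- f w)) => _; apply/andP; split; lra.
- apply: (@integrable_rvD (fun w => `|f w|) (fun=> 1)); last first.
    exact: integrable_rv_cst.
  exact: (integrable_norm If).
Qed.

(** A minimum of affine functions lies below each of them, so Jensen's
    inequality follows by integrating the two affine bounds separately. *)
Lemma jensen_pfun f : integrable_rv P f ->
  \int[P]_w pfun (f w) <= pfun (\int[P]_w f w).
Proof.
move=> If; have Ip := integrable_pfun If.
rewrite {2}/pfun le_min; apply/andP; split.
  rewrite -mulN1r -RintegralZl //; apply: le_Rintegral => //.
    exact: integrable_rvZ.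
  by move=> w _; rewrite mulN1r pfun_le_opp.
rewrite -[leRHS](Rintegral_prob_cst 1); apply: le_Rintegral => //.
  exact: integrable_rv_cst.
by move=> w _; exact: pfun_le1.
Qed.

Lemma cond_exp_Rintegral G f g : filtration G -> forall t,
  is_cond_exp P (G t) f g -> \int[P]_w g w = \int[P]_w f w.
Proof.
move=> [sG _ _] t [_ _ h]; rewrite /Rintegral h //.
by have [s0 sC _] := sG t; rewrite -(setD0 setT); exact: sC.
Qed.

(** Integrate the supermartingale inequality over the whole space at each
    step. *)
Lemma supermartingale_Rintegral G Z : filtration G -> supermartingale P G Z ->
  forall t, \int[P]_w Z t w <= \int[P]_w Z 0%N w.
Proof.
move=> GF [_ IZ sZ]; elim=> [//|t IH]; apply: le_trans IH.
have [Y YE YZ] := sZ t.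
rewrite -(cond_exp_Rintegral GF YE); apply: ae_le_Rintegral => //.
by case: YE.
Qed.

Lemma markov_Rintegral (E : set T) (c : R) Z : measurable E -> 0 < c ->
  integrable_rv P Z -> (forall w, 0 <= Z w) -> (forall w, E w -> c <= Z w) ->
  (P E <= (c^-1 * \int[P]_w Z w)%:E)%E.
Proof.
move=> mE c0 IZ Z0 cZ.
have PE : P E = (\int[P]_w \1_E w)%:E.
  by rewrite /Rintegral integral_indic // setIT fineK // fin_num_measure.
rewrite PE lee_fin ler_pdivlMl // -RintegralZl //.
  apply: le_Rintegral => //.
    by apply: integrable_rvZ; exact: integrable_indic.
  move=> w _; rewrite indicE; have [/set_mem Ew|_] := boolP (w \in E).
    by rewrite mulr1 cZ.
  by rewrite mulr0.
exact: integrable_indic.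
Qed.

Context {d : nat}.
Implicit Types (M : T -> 'M[R[i]]_d) (v : 'rV[R[i]]_d).

Lemma mx_expectationE M i j : mx_expectation P M i j =
  Complex (\int[P]_w complex.Re (M w i j)) (\int[P]_w complex.Im (M w i j)).
Proof. by rewrite mxE unlock. Qed.

Lemma mx_expectation_herm M : (forall w, M w \is hermsymmx) ->
  mx_integrable P M -> mx_expectation P M \is hermsymmx.
Proof.
move=> hM IM; apply/hermP => i j; rewrite !mx_expectationE /=; congr Complex.
  by apply: eq_Rintegral => w _; have /hermP -> := hM w; case: (M w j i).
rewrite -mulN1r -RintegralZl //; last by case: (IM j i).
apply: eq_Rintegral => w _; have /hermP -> := hM w; rewrite mulN1r.
by case: (M w j i).
Qed.

Lemma integrable_qform v M : mx_integrable P M ->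
  integrable_rv P (fun w => qform v (M w)).
Proof.
move=> IM; under eq_fun do rewrite qformE.
apply: integrable_rv_sum => i; apply: integrable_rv_sum => j.
by have [Ire Iim] := IM i j; apply: integrable_rvB; exact: integrable_rvZ.
Qed.

Lemma Rintegral_qform v M : mx_integrable P M ->
  \int[P]_w qform v (M w) = qform v (mx_expectation P M).
Proof.
move=> IM; rewrite qformE; under eq_Rintegral do rewrite qformE.
have Iij i j : integrable_rv P (fun w =>
    complex.Re (v 0 i * Num.conj (v 0 j)) * complex.Re (M w i j)
    - complex.Im (v 0 i * Num.conj (v 0 j)) * complex.Im (M w i j)).
  by have [Ire Iim] := IM i j; apply: integrable_rvB; exact: integrable_rvZ.
rewrite Rintegral_sum_rv => [|i]; last exact: integrable_rv_sum.
apply: eq_bigr => i _; rewrite Rintegral_sum_rv //.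
apply: eq_bigr => j _; have [Ire Iim] := IM i j.
rewrite RintegralB //; [|exact: integrable_rvZ..].
by rewrite !RintegralZl // mx_expectationE.
Qed.

End Expectation.

(** * Matrix martingales and the tail bound *)

Section MatrixMartingale.
Context {disp : measure_display} {T : measurableType disp} {R : realType}.
Variable P : probability T R.
Context {d : nat}.
Implicit Type v : 'rV[R[i]]_d.

(** Shifting the index keeps [X 0], of which nothing is known, out of the
    sum. *)
Lemma partial_sumS (X : nat -> T -> 'M[R[i]]_d) t w :
  partial_sum X t w = \sum_(0 <= i < t) X i.+1 w.
Proof. by rewrite /partial_sum big_add1. Qed.

Variables (F : nat -> set (set T)) (F_filt : filtration F).
Variables (X : nat -> T -> 'M[R[i]]_d) (X_mds : mx_martingale_difference P F X).

Lemma mds_integrable t : mx_integrable P (X t.+1).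
Proof. by have [] := X_mds (ltn0Sn t). Qed.

Lemma mds_expectation t : mx_expectation P (X t.+1) = 0.
Proof.
have [_ _ h] := X_mds (ltn0Sn t).
apply/matrixP => i j; rewrite mx_expectationE mxE.
have [hre him] := h i j.
rewrite -(cond_exp_Rintegral F_filt hre) -(cond_exp_Rintegral F_filt him).
by rewrite Rintegral_prob_cst.
Qed.

Lemma mds_partial_sum_integrable t : mx_integrable P (partial_sum X t).
Proof.
move=> i j; split.
  under eq_fun do rewrite partial_sumS summxE Re_sum.
  by apply: integrable_rv_sum => k; case: (mds_integrable k i j).
under eq_fun do rewrite partial_sumS summxE Im_sum.
by apply: integrable_rv_sum => k; case: (mds_integrable k i j).
Qed.

Lemma mds_partial_sum_qform v t : \int[P]_w qform v (partial_sum X t w) = 0.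
Proof.
under eq_Rintegral do rewrite partial_sumS qform_sum.
rewrite Rintegral_sum_rv => [|i]; last first.
  by apply: integrable_qform; exact: mds_integrable.
rewrite big1 // => i _; rewrite Rintegral_qform; last exact: mds_integrable.
by rewrite mds_expectation qform0.
Qed.

End MatrixMartingale.

Theorem theorem7p1 (disp : measure_display) (T : measurableType disp)
  (R : realType) (P : probability T R) (d : nat) (d_gt0 : (0 < d)%N)
  (F : nat -> set (set T)) (F_filt : filtration F)
  (X : nat -> T -> 'M[R[i]]_d)
  (X_sa : forall t w, (1 <= t)%N -> X t w \is hermsymmx)
  (X_mds : mx_martingale_difference P F X)
  (V : nat -> T -> 'M[R[i]]_d)
  (V_sa : forall t w, V t w \is hermsymmx)
  (V_adapted : forall t, mx_measurable_wrt (F t) (V t))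
  (V_int : forall t, mx_integrable P (V t))
  (V_0 : forall w, V 0%N w = 0)
  (thmax : \bar R) (thmax_gt0 : (0 < thmax)%E)
  (psi : R -> R) (psi_cgf : cgf_like thmax psi)
  (R_super : forall theta : R, cgf_dom thmax theta ->
     supermartingale P F (fun t w =>
       rtr (mxfun (@expR R)
              (theta%:C *: partial_sum X t w - (psi theta)%:C *: V t w)))) :
  forall (n : nat) (r sigma theta : R),
    (1 <= n)%N -> 0 < sigma -> cgf_dom thmax theta ->
    (P [set w | (r <= lambda_max (partial_sum X n w))%R
                /\ (lambda_max (V n w) <= sigma ^+ 2)%R]
     <= (expR 1 / (expR 1 - 1)
         * (rtr (mxfun (@pfun R)
                  (- ((psi theta)%:C *: mx_expectation P (V n)))) + 1)
         * expR (psi theta * sigma ^+ 2 - theta * r))%:E)%E.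
Proof.
move=> n r sigma theta _ _ th_dom.
have th0 : 0 <= theta by case: th_dom.
have psi0 := cgf_like_ge0 psi_cgf th_dom.
have superM := R_super theta th_dom.
pose S := partial_sum X n.
pose M w := theta%:C *: S w - (psi theta)%:C *: V n w.
pose B := - ((psi theta)%:C *: mx_expectation P (V n)).
(* A deterministic orthonormal eigenbasis of the mean of [M]. *)
pose Q := spectralmx B.
have hS w : S w \is hermsymmx.
  by rewrite /S partial_sumS; apply: herm_sum => i _; exact: X_sa.
have hM w : M w \is hermsymmx.
  by apply: hermD; [|apply: hermN]; exact: hermZ.
have hB : B \is hermsymmx.
  by apply/hermN/hermZ/mx_expectation_herm.
have IS : mx_integrable P S by exact: mds_partial_sum_integrable X_mds n.
have Iq i : integrable_rv P (fun w => qform (row i Q) (M w)).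
  under eq_fun do rewrite qformB !qformZ.
  by apply: integrable_rvB; apply: integrable_rvZ; exact: integrable_qform.
have Eq i : \int[P]_w qform (row i Q) (M w) = eigval B i.
  under eq_Rintegral do rewrite qformB !qformZ.
  have IqS := integrable_qform (row i Q) IS.
  have IqV := integrable_qform (row i Q) (V_int n).
  rewrite RintegralB //; [|exact: integrable_rvZ..].
  rewrite !RintegralZl // (mds_partial_sum_qform F_filt X_mds) mulr0.
  rewrite Rintegral_qform // -(qform_row_spectral i hB) -/Q.
  by rewrite /B -(sub0r (_ *: mx_expectation P (V n))) qformB qform0 qformZ.
pose tr_exp w := rtr (mxfun (@expR R) (M w)).
have Itr : integrable_rv P tr_exp by have [_ /(_ n)] := superM.
have Etr : \int[P]_w tr_exp w <= d%:R.
  apply: le_trans (supermartingale_Rintegral F_filt superM n) _.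
  (* At time 0 the exponent vanishes, so the trace is [tr I = d]. *)
  under eq_Rintegral do
    rewrite /partial_sum big_geq // V_0 !scaler0 subr0 rtr_mxfun.
  rewrite Rintegral_prob_cst (eq_bigr (fun=> 1)) => [|j _]; last first.
    by rewrite eigval0 expR0.
  by rewrite sumr_const card_ord.
pose Z w := tr_exp w - d%:R + \sum_i pfun (qform (row i Q) (M w)) + 1.
have uQ : Q \is unitarymx by exact: spectral_unitarymx.
have Zge w := trace_majorant uQ (hM w).
have Ip : integrable_rv P (fun w => \sum_i pfun (qform (row i Q) (M w))).
  by apply: integrable_rv_sum => i; exact: integrable_pfun.
have Id : integrable_rv P (fun w => tr_exp w - d%:R).
  by apply: integrable_rvB => //; exact: integrable_rv_cst.
have Idp : integrable_rv P (fun w =>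
    tr_exp w - d%:R + \sum_i pfun (qform (row i Q) (M w))).
  exact: integrable_rvD.
have I1 : integrable_rv P (fun=> 1) by exact: integrable_rv_cst.
have IZ : integrable_rv P Z by exact: integrable_rvD.
have EZ : \int[P]_w Z w <= rtr (mxfun (@pfun R) B) + 1.
  rewrite RintegralD // RintegralD // RintegralB //; last first.
    exact: integrable_rv_cst.
  rewrite !Rintegral_prob_cst lerD2r -[leRHS]add0r lerD ?subr_le0 //.
  rewrite rtr_mxfun Rintegral_sum_rv => [|i]; last exact: integrable_pfun.
  by apply: ler_sum => i _; rewrite -Eq jensen_pfun.
pose u0 := theta * r - psi theta * sigma ^+ 2.
pose c := (expR 1 - 1) / expR 1 * expR u0 : R.
have e1 : 0 < expR 1 - 1 :> R by rewrite subr_gt0 expR_gt1.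
have c0 : 0 < c by rewrite mulr_gt0 ?expR_gt0 // divr_gt0 ?expR_gt0.
set E := [set w | _].
have mE : measurable E.
  have mS : measurable_fun setT (fun w => lambda_max (S w)).
    apply: measurable_lambda_max => // i j.
    by have [Ire Iim] := IS i j; split;
      [exact: integrable_rv_measurable Ire | exact: integrable_rv_measurable Iim].
  have mV : measurable_fun setT (fun w => lambda_max (V n w)).
    apply: measurable_lambda_max => // i j.
    by have [Ire Iim] := V_int n i j; split;
      [exact: integrable_rv_measurable Ire | exact: integrable_rv_measurable Iim].
  have := measurable_fun_ler (measurable_cst r) mS.
  move=> /(_ measurableT [set true] I); rewrite setTI => mrS.
  have := measurable_fun_ler mV (measurable_cst (sigma ^+ 2)).
  move=> /(_ measurableT [set true] I); rewrite setTI => mVs.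
  exact: (measurableI _ _ mrS mVs).
have ZE w : E w -> c <= Z w.
  move=> [rS Vs]; have [j [jM _]] := lambda_max_eigval d_gt0 (hM w).
  apply: le_trans (proj2 (Zge w) j); apply: ler_wpM2l.
    by rewrite ltW // divr_gt0 // expR_gt0.
  rewrite ler_expR -jM.
  apply: le_trans (lambda_maxB_ge _ d_gt0 psi0 (hS w) (V_sa n w)).
  by rewrite /u0 lerB // ler_wpM2l.
apply: le_trans (markov_Rintegral mE c0 IZ (fun w => proj1 (Zge w)) ZE) _.
rewrite lee_fin -/B (_ : psi theta * _ - _ = - u0); last by rewrite opprB.
rewrite mulrAC (_ : expR 1 / _ * _ = c^-1); last first.
  by rewrite expRN /c invfM invf_div.
by rewrite ler_wpM2l // invr_ge0 ltW.
Qed.
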